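(* Let $G$ be a finite group and let $P$ be a Sylow $2$-subgroup of $G$. Then $k_2(G) > |P|/2$ if and only if $G$ has a normal $2$-complement and $k(P) > |P|/2$.
   Context: For a finite group $H$, $k(H)$ denotes the number of conjugacy classes of $H$. For a prime $p$, a $p$-element is an element whose order is a power of $p$ (including the identity), and $k_p(G)$ denotes the number of conjugacy classes of $G$ consisting of $p$-elements. A normal $p$-complement of $G$ is a normal subgroup of order prime to $p$ whose index in $G$ is a power of $p$. *)

(* Defs.v *)
From mathcomp Require Import all_boot all_fingroup all_solvable.

Set Implicit Arguments.
Unset Strict Implicit.
Unset Printing Implicit Defensive.

Import GroupScope.

(* k(G) is #|classes G|. *)

Definition num_p_classes (gT : finGroupType) (p : nat) (G : {group gT}) : nat :=
  #|[set C in classes G | [forall x in C, p.-elt x]]|.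

Definition normal_p_complement (gT : finGroupType) (p : nat)
    (G N : {group gT}) : bool :=
  [&& N <| G, p^'.-group N & p.-nat #|G : N|].

(* Main.v *)
Require Import Defs.
From mathcomp Require Import all_boot all_fingroup all_solvable.
From mathcomp Require Import all_algebra all_field all_character.
From mathcomp Require Import zify.

Set Implicit Arguments.
Unset Strict Implicit.
Unset Printing Implicit Defensive.

Import GroupScope.

(* Character degrees give k(P) <= |P| / 4 + 3 |P : P'| / 4, so k(P) > |P| / 2
   forces |P'| <= 2 and every centraliser R = C_P(x) has index at most 2. If
   some element of odd order in N_G(R) acts nontrivially on R, it fuses the
   classes of P so much that k_2(G) <= |P| / 2. Otherwise
   N_G(R) = C_G(R) P for all such R, and as they are all normal in P a Sylow
   argument shows that P controls fusion, whence transfer gives a normal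
   2-complement. *)

(** * Counting classes of $p$-elements inside a Sylow subgroup *)

Lemma mul_card_imset_leq (T U : finType) (f : T -> U) (S : {set T}) (c : nat) :
    {in S, forall x, c <= #|[set y in S | f y == f x]|} ->
  (c * #|f @: S| <= #|S|)%N.
Proof.
move=> fib_ge; rewrite mulnC -sum_nat_const.
have -> : #|S| = (\sum_(u in f @: S) #|[set y in S | f y == u]|)%N.
  rewrite -sum1_card (partition_big_imset f) /=; apply: eq_bigr => u _.
  by rewrite -sum1_card; apply: eq_bigl => y; rewrite inE.
by apply: leq_sum => _ /imsetP[x Sx ->]; apply: fib_ge.
Qed.

(** By Sylow, every $p$-element has a conjugate in [P], so the classes counted are those that meet
    [P]. *)
Lemma num_p_classes_Sylow (gT : finGroupType) (p : nat) (G P : {group gT}) :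
  p.-Sylow(G) P -> num_p_classes p G = #|(fun x => x ^: G) @: P|.
Proof.
move=> sylP; apply: eq_card => C; rewrite inE.
have sPG := pHall_sub sylP.
apply/andP/imsetP=> [[/imsetP[x Gx ->] /forall_inP p_x] | [x Px ->]].
  have [||g Gg] := Sylow_Jsub (Q := <[x]>) sylP; rewrite ?cycle_subG //.
    by apply: p_x; apply: class_refl.
  rewrite -cycleJ cycle_subG => Pxg.
  by exists (x ^ g) => //; rewrite classGidl.
split; first by apply: mem_classes; apply: (subsetP sPG).
apply/forall_inP=> _ /imsetP[g _ ->]; rewrite p_eltJ.
exact: mem_p_elt (pHall_pgroup sylP) Px.
Qed.

(** Writes the [G]-classes meeting [P] as an image of [classes P]: fusion can only lower the count,
    and keeps it exactly when this map is injective. *)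
Lemma imset_class_support (gT : finGroupType) (G P : {group gT}) :
    P \subset G ->
  (fun x => x ^: G) @: P = (fun C => class_support C G) @: classes P.
Proof.
move=> sPG; rewrite -imset_comp; apply: eq_in_imset => x Px /=.
by rewrite -classM mulSGid.
Qed.

(** * Transfer and normal $p$-complements *)

(** The $p'$-part of [x] dies in the quotient, so the coset of [x] is a $p$-element; by Cauchy no
    other prime divides the order. *)
Lemma p_quotient_of_p'_elts (gT : finGroupType) (p : nat) (G K : {group gT}) :
    G \subset 'N(K) -> {in G, forall x, p^'.-elt x -> x \in K} ->
  p.-group (G / K).
Proof.
move=> nKG p'K; apply/pgroupP=> q q_pr.
case/(Cauchy q_pr)=> _ /morphimP[x Nx Gx ->] ox.
have p'1: coset K x.`_p^' = 1.
  by apply: coset_id; apply: p'K; rewrite ?groupX // p_elt_constt.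
have p_xK: p.-elt (coset K x).
  rewrite -(consttC p x) morphM ?groupX //= [X in _ * X]p'1 mulg1.
  by rewrite morph_p_elt ?groupX // p_elt_constt.
by move: p_xK; rewrite /p_elt ox pnatE.
Qed.

(** [L] is the kernel of the transfer into [Q / H]. On [Q] the transfer is the power map of exponent
    [#|G : Q|] modulo [H], injective on [Q / H] because this exponent is prime to [p]. *)
Lemma transfer_focal (gT : finGroupType) (p : nat) (G Q H : {group gT}) :
    p.-Sylow(G) Q -> H \subset Q ->
    {in Q & G, forall u g, u ^ g \in Q -> [~ u, g] \in H} ->
  exists L : {group gT}, [/\ L <| G, p.-group (G / L) & Q :&: L \subset H].
Proof.
move=> sylQ sHQ focH; have [sQG pQ p'Q] := and3P sylQ.
have sQ'H: Q^`(1) \subset H.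
  rewrite derg1 gen_subG; apply/subsetP=> _ /imset2P[u v Qu Qv ->].
  by rewrite focH ?groupJ // (subsetP sQG).
have nHQ: Q \subset 'N(H).
  by rewrite -commg_subl (subset_trans _ sQ'H) // derg1 commSg.
pose alpha := restrm_morphism nHQ (coset_morphism H).
have abQ: abelian (alpha @* Q).
  by rewrite morphim_restrm setIid /=; apply: sub_der1_abelian.
pose V := transfer_morphism G abQ.
have VQ u: u \in Q -> V u = (FiniteModule.fmod abQ (alpha u) *+ #|G : Q|)%R.
  move=> Qu; have Gu := subsetP sQG u Qu.
  have trX := transversalP (rcosets_cycle_partition sQG Gu).
  rewrite /= (transfer_cycle_expansion sQG abQ Gu trX).
  rewrite -(sum_index_rcosets_cycle sQG Gu trX) -GRing.sumrMnr.
  apply: eq_bigr => x Xx; set n := #|_ : _|.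
  have Gx: x \in G := subsetP (transversal_sub trX) x Xx.
  (* The transfer factor at [x] is this conjugate, which lies in [Q] and hence agrees with [u ^+ n]
     modulo [H]; the exponents [n] add up to [#|G : Q|]. *)
  have Qun: (u ^+ n) ^ x^-1 \in Q.
    by rewrite conjgE invgK mulgA -mem_rcoset mulg_exp_card_rcosets.
  have Hun: [~ u ^+ n, x^-1] \in H by rewrite focH ?groupX ?groupV.
  rewrite -FiniteModule.fmodX ?mem_morphim // -morphX //=.
  by rewrite conjg_mulR /restrm /= coset_kerr.
exists ('ker V)%G; split; first exact: ker_normal.
  rewrite /pgroup (card_isog (first_isog V)) -/(pgroup p (V @* G)).
  have pT: p.-group (FiniteModule.fmod_morphism abQ @* (alpha @* Q)).
    by rewrite !morphim_pgroup.
  apply: pgroupS pT; apply/subsetP=> v _.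
  rewrite -(FiniteModule.fmvalK v).
  by apply: (mem_morphim (FiniteModule.fmod_morphism abQ));
    apply: FiniteModule.fmodP.
apply/subsetP=> u /setIP[Qu /mker]; rewrite VQ // => u_m.
have Qau: alpha u \in alpha @* Q by apply: mem_morphim.
have au_m: alpha u ^+ #|G : Q| = 1.
  move: u_m; rewrite -FiniteModule.fmodX // => /(congr1 val).
  by rewrite FiniteModule.fmodK ?groupX.
have au1: alpha u = 1.
  apply/eqP; rewrite -order_eq1 -dvdn1.
  have co_p: coprime #[alpha u] #|G : Q|.
    apply: pnat_coprime p'Q; apply: mem_p_elt Qau.
    exact: morphim_pgroup.
  by rewrite -(eqP co_p) dvdn_gcd dvdnn order_dvdn au_m /=.
by apply: coset_idr au1; apply: (subsetP nHQ).
Qed.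

(* The residual K = O^p(G) is generated by p'-elements, so the transfer of K
   into Q / [Q, P], for Q = P :&: K, is trivial; P-fusion makes it act on Q as
   a power map coprime to p. Hence Q = [Q, P], and Q = 1 by nilpotence. *)
Lemma normal_p_complement_of_fusion (gT : finGroupType) (p : nat)
    (G P : {group gT}) :
    p.-Sylow(G) P ->
    {in P & G, forall x g, x ^ g \in P -> x ^ g \in x ^: P} ->
  exists N : {group gT}, normal_p_complement p G N.
Proof.
move=> sylP fusP; have [sPG pP _] := and3P sylP.
pose K := <<[set x in G | p^'.-elt x]>>%G.
have sKG: K \subset G.
  by rewrite gen_subG; apply/subsetP=> x; rewrite inE => /andP[].
have nKG: G \subset 'N(K).
  apply/subsetP=> g Gg; rewrite inE /= -genJ genS //.
  apply/subsetP=> _ /imsetP[x + ->]; rewrite !inE p_eltJ => /andP[Gx ->].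
  by rewrite groupJ.
have nsKG: K <| G by apply/andP.
have p'K: {in G, forall x, p^'.-elt x -> x \in K}.
  by move=> x Gx p'x; rewrite mem_gen // inE Gx.
exists K; rewrite /normal_p_complement nsKG -card_quotient //.
have p_GK := p_quotient_of_p'_elts nKG p'K; apply/andP; split=> //.
pose Q := (K :&: P)%G.
have sylQ: p.-Sylow(K) Q := Sylow_setI_normal nsKG sylP.
have [sQK pQ _] := and3P sylQ.
have nQP: P \subset 'N(Q) by rewrite normsI ?normG // (subset_trans sPG).
pose H := [~: Q, P]%G.
have sHQ: H \subset Q by rewrite commg_subl.
have sQP: Q \subset P by apply: subsetIr.
have focH: {in Q & K, forall u g, u ^ g \in Q -> [~ u, g] \in H}.
  move=> u g Qu Kg Qug.
  have /imsetP[v Pv ug_v]: u ^ g \in u ^: P.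
    by apply: fusP; rewrite ?(subsetP sQP) ?(subsetP sKG).
  by rewrite commgEl ug_v -commgEl mem_commg.
have [L [nsLK p_KL sQLH]] := transfer_focal sylQ sHQ focH.
have sKL: K \subset L.
  rewrite gen_subG; apply/subsetP=> x; rewrite inE => /andP[Gx p'x].
  have Kx := p'K x Gx p'x; have nLx := subsetP (normal_norm nsLK) x Kx.
  apply: coset_idr => //; apply/eqP; rewrite -order_eq1.
  apply/eqP; apply: (@pnat_1 p); last exact: morph_p_elt.
  by apply: mem_p_elt p_KL _; apply: mem_quotient.
have Q1: Q :=: 1.
  apply/eqP; apply: contraT => ntQ.
  have /andP[_ /negP[]]: H \proper Q.
    by apply: nil_comm_properl (pgroup_nil pP) sQP ntQ _; rewrite subsetI subxx.
  apply: subset_trans sQLH.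
  by rewrite subsetI subxx (subset_trans sQK).
by apply/andP; split=> //; rewrite /pgroup -indexg1 -Q1; case/and3P: sylQ.
Qed.

(** * Local control of fusion *)

Lemma index_leq_p_normal (gT : finGroupType) (p : nat) (P T : {group gT}) :
  prime p -> p.-group P -> T \subset P -> #|P : T| <= p -> T <| P.
Proof.
move=> p_pr pP sTP leTp; have [/eqP|tiP] := eqVneq #|P : T| 1%N.
  by rewrite indexg_eq1 /normal sTP => /subset_trans->; rewrite ?normG.
apply: (p_maximal_normal pP); apply: p_index_maximal => //.
have [k ik] := p_natP (pnat_dvd (dvdn_indexg P T) pP).
suff -> : #|P : T| = p by [].
apply/eqP; rewrite eqn_leq leTp ik; case: k ik => [ik | k _].
  by rewrite ik in tiP.
by rewrite expnS leq_pmulr // expn_gt0 prime_gt0.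
Qed.

(** The element [g] is first corrected inside $C_G(z)$ to some [f] carrying $R = C_P(x)$ into [P].
    Since [R] and its image are normal in [P], a Sylow argument shows that [f] normalises [R]; its
    factor in $C_G(R)$ then fixes [x], and its factor in [P] does the fusion. *)
Lemma fusion_to_fully_centralised (gT : finGroupType) (p : nat)
    (G P : {group gT}) (x z g : gT) :
    prime p -> p.-Sylow(G) P -> {in P, forall y, #|P : 'C_P[y]| <= p} ->
    {in P, forall y, 'N_G('C_P[y]) \subset 'C_G('C_P[y]) * P} ->
    p.-Sylow('C_G[z]) 'C_P[z] ->
    x \in P -> z \in P -> g \in G -> x ^ g = z ->
  z \in x ^: P.
Proof.
move=> p_pr sylP le_p autP sylz Px Pz Gg xg_z; have [sPG pP _] := and3P sylP.
pose R := 'C_P[x]%G; have sRP: R \subset P by apply: subsetIl.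
have Gz: z \in G := subsetP sPG z Pz.
have sRgC: R :^ g \subset 'C_G[z].
  rewrite subsetI -xg_z cent1J conjSg subsetIr andbT.
  by rewrite -(conjGid Gg) conjSg (subset_trans sRP).
have [|h Ch sRhP] := Sylow_Jsub sylz sRgC.
  by rewrite pgroupJ (pgroupS sRP).
have [Gh czh] := setIP Ch.
pose f := g * h; have Gf: f \in G by rewrite groupM.
have xf_z: x ^ f = z.
  rewrite conjgM xg_z; apply/conjg_fixP/commgP; apply: commute_sym.
  exact/cent1P.
pose T := (R :^ f)%G.
have sTP: T \subset P by rewrite /= conjsgM (subset_trans sRhP) ?subsetIl.
have nsRP: R <| P by apply: index_leq_p_normal (le_p x Px).
have nsTP: T <| P.
  apply: (index_leq_p_normal p_pr pP sTP); apply: leq_trans (le_p x Px).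
  by rewrite -!divgS //= cardJg.
(* Both [P] and [P :^ f] normalise [T], so some [n] in ['N_G(T)] makes [f * n] normalise [P]. *)
have sylTP: p.-Sylow('N_G(T)) P.
  by apply: pHall_subl sylP; rewrite ?subsetIl // subsetI sPG normal_norm.
have sylTPf: p.-Sylow('N_G(T)) (P :^ f).
  apply: pHall_subl (subsetIl _ _) _; last by rewrite -(conjGid Gf) pHallJ2.
  by rewrite subsetI /= normJ conjSg normal_norm // andbT -(conjGid Gf) conjSg.
have [n /setIP[Gn nTn] defP] := Sylow_trans sylTPf sylTP.
have NPfn: f * n \in 'N_G(P).
  by rewrite inE groupM //; apply/normP; rewrite conjsgM -defP.
(* The instance $y = 1$, where $C_P(1) = P$, concerns $N_G(P)$ itself. *)
have := autP 1 (group1 P); rewrite cent11T setIT => /subsetP/(_ _ NPfn).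
case/mulsgP=> c u /setIP[_ cPc] Pu def_fn.
(* [f * n] sends [R] to [T], yet it normalises [R], being a product of an element centralising [P]
   and one of [P]. *)
have defT: R :^ f = R.
  have nRfn: f * n \in 'N(R).
    rewrite def_fn groupM //; last exact: (subsetP (normal_norm nsRP)).
    by apply: (subsetP (cent_sub R)); apply: (subsetP (centS sRP)).
  rewrite -[RHS](normP nRfn) conjsgM; apply: esym; exact: (normP nTn).
have /(subsetP (autP x Px)) : f \in 'N_G(R).
  by rewrite inE Gf; apply/normP.
case/mulsgP=> c1 u1 /setIP[_ cRc1] Pu1 def_f.
rewrite -xf_z def_f conjgM; apply/imsetP; exists u1 => //.
congr (_ ^ _); apply/conjg_fixP/commgP; apply: commute_sym.
by apply: (centP cRc1); rewrite inE Px cent1id.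
Qed.

(** Enlarge $C_P(x)$ to a Sylow subgroup [Q] of $C_G(x)$ and conjugate [Q] into [P]. *)
Lemma fully_centralised_conj (gT : finGroupType) (p : nat)
    (G P : {group gT}) (x : gT) :
    p.-Sylow(G) P -> x \in P ->
  exists2 g, g \in G & x ^ g \in P /\ p.-Sylow('C_G[x ^ g]) 'C_P[x ^ g].
Proof.
move=> sylP Px; have [sPG pP _] := and3P sylP.
have sCPG: 'C_P[x] \subset 'C_G[x] by apply: setSI.
have [Q sylQ sCQ] := Sylow_superset sCPG (pgroupS (subsetIl _ _) pP).
have [sQC pQ _] := and3P sylQ.
have [g Gg sQgP] := Sylow_Jsub sylP (subset_trans sQC (subsetIl _ _)) pQ.
have Qx: x \in Q by rewrite (subsetP sCQ) // inE Px cent1id.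
exists g => //; split; first by rewrite (subsetP sQgP) ?memJ_conjg.
have sylQg: p.-Sylow('C_G[x ^ g]) (Q :^ g).
  by rewrite cent1J -{1}(conjGid Gg) -conjIg pHallJ2.
suff -> : 'C_P[x ^ g] = Q :^ g by [].
(* The other inclusion follows from orders: ['C_P[x ^ g]] is a $p$-subgroup of a group in which
   [Q :^ g] is Sylow. *)
apply/eqP; rewrite eq_sym eqEcard subsetI sQgP cent1J conjSg /=.
rewrite (subset_trans sQC) ?subsetIr //=.
have [h _ sCh] := Sylow_subJ sylQg (setSI _ sPG) (pgroupS (subsetIl _ _) pP).
by rewrite -(cardJg (Q :^ g) h) subset_leq_card // -cent1J.
Qed.

(** Both [x] and [x ^ g] are fused within [P] to one common fully centralised conjugate. *)
Lemma fusion_of_local_control (gT : finGroupType) (p : nat) (G P : {group gT}) :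
    prime p -> p.-Sylow(G) P -> {in P, forall y, #|P : 'C_P[y]| <= p} ->
    {in P, forall y, 'N_G('C_P[y]) \subset 'C_G('C_P[y]) * P} ->
  {in P & G, forall x g, x ^ g \in P -> x ^ g \in x ^: P}.
Proof.
move=> p_pr sylP le_p autP x g Px Gg Pxg.
have [h Gh [Pz sylz]] := fully_centralised_conj sylP Pxg.
have fus y k :
    y \in P -> k \in G -> y ^ k = (x ^ g) ^ h -> (x ^ g) ^ h \in y ^: P.
  move=> Py Gk.
  exact: (fusion_to_fully_centralised p_pr sylP le_p autP sylz Py Pz Gk).
have /class_eqP eq_x : (x ^ g) ^ h \in x ^: P.
  by apply: (fus x (g * h)) => //; rewrite ?groupM ?conjgM.
have /class_eqP eq_xg : (x ^ g) ^ h \in (x ^ g) ^: P by apply: (fus _ h).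
by rewrite -eq_x eq_xg class_refl.
Qed.

(** * Consequences of control of fusion, and complements as a source of it *)

Lemma num_p_classes_of_fusion (gT : finGroupType) (p : nat) (G P : {group gT}) :
    p.-Sylow(G) P -> {in P & G, forall x g, x ^ g \in P -> x ^ g \in x ^: P} ->
  num_p_classes p G = #|classes P|.
Proof.
move=> sylP fusP; have sPG := pHall_sub sylP.
rewrite (num_p_classes_Sylow sylP) (imset_class_support sPG).
apply: card_in_imset => _ _ /imsetP[x Px ->] /imsetP[y Py ->].
rewrite -!classM !mulSGid // => eq_xy.
have /imsetP[g Gg def_y]: y \in x ^: G by rewrite eq_xy class_refl.
by apply/class_eqP; rewrite class_sym def_y fusP // -def_y.
Qed.

(** Write $g = nu$ with $n \in N$ and $u \in P$. Then $[x, n]$ lies in $N \cap P = 1$, so [g] acts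
    on [x] as [u] does. *)
Lemma fusion_of_normal_p_complement (gT : finGroupType) (p : nat)
    (G N P : {group gT}) :
    p.-Sylow(G) P -> normal_p_complement p G N ->
  {in P & G, forall x g, x ^ g \in P -> x ^ g \in x ^: P}.
Proof.
move=> sylP /and3P[nsNG p'N p_GN] x g Px Gg Pxg.
have [sPG pP p'GP] := and3P sylP.
have tiNP : N :&: P = 1.
  by apply: coprime_TIg; rewrite coprime_sym (pnat_coprime pP).
have defG : N * P = G.
  apply/eqP; rewrite eqEsubset mulG_subG (normal_sub nsNG) sPG /=.
  rewrite -quotientSK ?normal_norm //.
  have nNP := subset_trans sPG (normal_norm nsNG).
  rewrite (pHall_id (quotient_pHall nNP sylP)) //.
  by rewrite /pgroup card_quotient ?normal_norm.
move: (Gg); rewrite -defG => /mulsgP[n u Nn Pu def_g].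
move: Pxg; rewrite def_g conjgM => Pxnu.
have Pxn: x ^ n \in P by rewrite -(memJ_conjg _ u) conjGid.
suff -> : x ^ n = x by apply: imset_f.
apply/conjg_fixP; rewrite -in_set1 -set1gE -tiNP inE andbC.
rewrite {1}commgEl groupM ?groupV //=.
have nNx: x \in 'N(N) by rewrite (subsetP (normal_norm nsNG)) ?(subsetP sPG).
by rewrite commgEr groupM // memJ_norm ?groupV.
Qed.

(** * Number of classes and the derived subgroup *)

(** There are $|G : G'|$ linear characters and the others have degree at least 2, so the sum of
    squares gives $4k(G) \le |G| + 3|G : G'|$. If $|G'| \ge 3$, the right side is at most $2|G|$. *)
Lemma card_der1_of_many_classes (gT : finGroupType) (G : {group gT}) :
  #|G| < 2 * #|classes G| -> #|G^`(1)| <= 2.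
Proof.
move=> many; pose d (i : Iirr G) := irr_degree (socle_of_Iirr i).
pose lin := [pred i : Iirr G | 'chi_i \is a linear_char]%R.
have sum_d : (\sum_i d i ^ 2 = #|G|)%N.
  apply/eqP; rewrite -algC.eqC_nat -irr_sum_square GRing.natr_sum; apply/eqP.
  by apply: eq_bigr => i _; rewrite irr1_degree GRing.natrX.
have card_lin : #|G : G^`(1)| = (\sum_i (i \in lin))%N.
  by rewrite -card_lin_irr -sum1_card big_mkcond.
have d_ge i : (4 <= d i ^ 2 + 3 * (i \in lin))%N.
  have d_gt0 : (0 < d i)%N by apply: irr_degree_gt0.
  have [d_gt1 | d_le1] := ltnP 1 (d i).
    by rewrite (leq_trans _ (leq_addr _ _)) // (@leq_exp2r 2 _ 2).
  have d1 : d i = 1%N by apply/eqP; rewrite eqn_leq d_le1.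
  suff -> : i \in lin by rewrite d1.
  by rewrite inE qualifE /= irr_char irr1_degree -/(d i) d1 eqxx.
have le4k : (4 * #|classes G| <= #|G| + 3 * #|G : G^`(1)|)%N.
  rewrite -NirrE -sum_d card_lin big_distrr -big_split /=.
  rewrite -[X in (4 * X)%N]card_ord mulnC -sum_nat_const.
  by apply: leq_sum => i _; apply: d_ge.
rewrite leqNgt; apply/negP => gt2.
have le3 : (3 * #|G : G^`(1)| <= #|G|)%N.
  by rewrite -(Lagrange (der_sub 1 G)) leq_mul2r gt2 orbT.
have : (#|G| + #|G| < #|G| + #|G|)%N.
  apply: leq_trans (leq_trans le4k _); last by rewrite leq_add2l.
  by rewrite addnn -mul2n -[4]/(2 * 2)%N -mulnA ltn_pmul2l.
by rewrite ltnn.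
Qed.

(** * Actions of coprime order and the fusion they force *)

(** The index of $C_R(a)$ is a power of 2, and it is not 1. Index 2 would make [a] trivial on both
    $C_R(a)$ and its quotient, hence on [R] by coprimeness. *)
Lemma odd_fix_index (gT : finGroupType) (R : {group gT}) (a : gT) :
    2.-group R -> a \in 'N(R) -> odd #[a] -> ~~ (a \in 'C(R)) ->
  4 * #|'C_R[a]| <= #|R|.
Proof.
move=> pR nRa odd_a ncRa; pose F := 'C_R[a]%G.
have sFR : F \subset R by apply: subsetIl.
have [k ik] := p_natP (pnat_dvd (dvdn_indexg R F) pR).
rewrite -(Lagrange sFR) mulnC leq_pmul2l ?cardG_gt0 // ik.
case: k ik => [|[|k]] ik; last first.
- by rewrite !expnS mulnA leq_pmulr // expn_gt0.
- have nsFR : F <| R.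
    apply: (p_maximal_normal pR); apply: p_index_maximal => //.
    by rewrite ik.
  have [r Rr nFr] : exists2 r, r \in R & r \notin F.
    by apply/subsetPn; rewrite -indexg_eq1 ik.
  have Rra : r ^ a \in R by rewrite memJ_norm.
  have nFra : r ^ a \notin F.
    by move: nFr; rewrite /= !in_setI Rr Rra /= groupJr ?cent1id.
  have Ff : [~ r, a] \in F.
    have nFR := normal_norm nsFR.
    have /cards1P[c RF1] : #|(R / F)^#| == 1%N.
      have: #|R / F| = 2 by rewrite card_quotient // ik.
      by rewrite (cardsD1 1) group1 add1n => -[->].
    have cosetF s : s \in R -> s \notin F -> coset F s = c.
      move=> Rs nFs; apply/set1P; rewrite -RF1 !inE mem_quotient // andbT.
      by apply: contraNneq nFs => /coset_idr->; rewrite ?(subsetP nFR).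
    apply: coset_idr; first by rewrite (subsetP nFR) // commgEl groupM ?groupV.
    rewrite commgEl morphM ?groupV ?(subsetP nFR) // morphV ?(subsetP nFR) //=.
    by rewrite !cosetF // mulVg.
  (* At $k$ the order of [a] this shows that the order of the $2$-element [[~ r, a]] divides an odd
     number. *)
  have ra_k k : r ^ (a ^+ k) = r * [~ r, a] ^+ k.
    elim: k => [|k IHk]; first by rewrite conjg1 mulg1.
    have cfa : [~ r, a] ^ a = [~ r, a].
      by apply/conjg_fixP/commgP/cent1P; case/setIP: Ff => _; rewrite cent1C.
    rewrite expgSr conjgM IHk conjMg conjXg cfa expgS mulgA.
    by rewrite (conjg_mulR r).
  have := ra_k #[a]; rewrite expg_order conjg1 -{1}[r]mulg1.
  move/mulgI/esym => fa1.
  case/negP: nFr; rewrite inE Rr; apply/cent1P/commgP.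
  rewrite -order_eq1 -dvdn1.
  have co : coprime #[[~ r, a]] #[a].
    apply: (@pnat_coprime 2); last by rewrite -odd_2'nat.
    exact: mem_p_elt pR (subsetP sFR _ Ff).
  by rewrite -(eqP co) dvdn_gcd dvdnn order_dvdn fa1 /=.
move/eqP: ik; rewrite expn0 indexg_eq1 => sRF.
case/negP: ncRa; rewrite -sub_cent1; apply: subset_trans sRF _; exact: subsetIr.
Qed.

(** The class of [x] lies in the coset $xG'$. *)
Lemma index_cent1_leq_der1 (gT : finGroupType) (G : {group gT}) (x : gT) :
  x \in G -> #|G : 'C_G[x]| <= #|G^`(1)|.
Proof.
move=> Gx; rewrite index_cent1 -(card_lcoset _ x) subset_leq_card //.
apply/subsetP=> _ /imsetP[g Gg ->]; rewrite mem_lcoset -commgEl.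
exact: mem_commg.
Qed.

(** If all $p'$-elements of $N_G(R)$ centralised [R], then $N_G(R)/C_G(R)$ would be a $p$-group,
    hence the image of its Sylow subgroup [P]. *)
Lemma exists_p'elt_not_cent (gT : finGroupType) (p : nat) (G P R : {group gT}) :
    p.-Sylow(G) P -> R <| P -> ~~ ('N_G(R) \subset 'C_G(R) * P) ->
  exists a, [/\ a \in 'N_G(R), p^'.-elt a & a \notin 'C(R)].
Proof.
move=> sylP nsRP notsub; have [sPG pP _] := and3P sylP.
have [|none] := boolP [exists a in 'N_G(R), p^'.-elt a && (a \notin 'C(R))].
  by case/exists_inP=> a Na /andP[p'a ncRa]; exists a.
case/negP: notsub.
have nCN : 'N_G(R) \subset 'N('C_G(R)).
  rewrite normsI ?norms_cent ?subsetIr //.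
  by rewrite (subset_trans (subsetIl _ _)) ?normG.
have p_N : p.-group ('N_G(R) / 'C_G(R)).
  apply: p_quotient_of_p'_elts => // a Na p'a.
  rewrite inE (subsetP (subsetIl _ _) a Na).
  by apply: contraR none => ncRa; apply/exists_inP; exists a; rewrite ?p'a.
have sylPN : p.-Sylow('N_G(R)) P.
  by apply: pHall_subl sylP; rewrite ?subsetIl // subsetI sPG normal_norm.
have nCP := subset_trans (pHall_sub sylPN) nCN.
by rewrite -quotientSK // (pHall_id (quotient_pHall nCP sylPN)).
Qed.

(* The fixed points of a fill at most a quarter of R and its other orbits have
   at least three elements, so R meets at most |R| / 2 classes; the elements
   outside R are not central in P, hence pair up. *)
Lemma num_2classes_leq_half (gT : finGroupType) (G P R : {group gT}) (a : gT) :
    2.-Sylow(G) P -> R <| P -> 'Z(P) \subset R ->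
    a \in 'N_G(R) -> odd #[a] -> a \notin 'C(R) ->
  2 * num_p_classes 2 G <= #|P|.
Proof.
move=> sylP nsRP sZR /setIP[Ga nRa] odd_a ncRa.
have [sPG pP _] := and3P sylP; have [sRP nRP] := andP nsRP.
rewrite (num_p_classes_Sylow sylP); pose f x := x ^: G; pose F := 'C_R[a].
have F4 : (4 * #|F| <= #|R|)%N by apply: odd_fix_index => //; apply: pgroupS pP.
have fF : (1 * #|f @: F| <= #|F|)%N by rewrite mul1n leq_imset_card.
have fRF : (3 * #|f @: (R :\: F)| <= #|R :\: F|)%N.
  apply: mul_card_imset_leq => x /setDP[Rx nFx].
  have xa : x ^ a != x.
    apply: contra nFx => /eqP/conjg_fixP/commgP cxa.
    by rewrite inE Rx; apply/cent1P.
  have xaa : x ^ (a ^+ 2) != x.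
    apply: contra nFx => /eqP/conjg_fixP/commgP cxaa.
    (* As [a] has odd order $m$, it is the power of exponent $(m+1)/2$ of $a^2$. *)
    have := commuteX #[a].+1./2 cxaa.
    rewrite -expgM mul2n halfK /= odd_a subn0 expgS expg_order mulg1 => cxa.
    by rewrite inE Rx; apply/cent1P.
  have nxa_xaa : x ^ a != x ^ (a ^+ 2).
    by rewrite expgS conjgM (inj_eq (conjg_inj a)) eq_sym.
  have fib k : x ^ (a ^+ k) \in [set y in R :\: F | f y == f x].
    have Rxak : x ^ (a ^+ k) \in R by rewrite memJ_norm ?groupX.
    rewrite inE /f classGidl ?groupX // eqxx andbT in_setD Rxak andbT.
    move: nFx; rewrite !in_setI Rx Rxak /=.
    by rewrite groupJr ?groupX ?cent1id.
  have: [set x; x ^ a; x ^ (a ^+ 2)] \subset [set y in R :\: F | f y == f x].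
    apply/subsetP=> y; rewrite !inE -orbA => /or3P[]/eqP->.
    - by have := fib 0; rewrite conjg1 !inE.
    - by have := fib 1%N; rewrite !inE.
    by have := fib 2; rewrite !inE.
  move/subset_leq_card; rewrite -setUA cardsU1 cards2 !inE nxa_xaa.
  by rewrite ![x == _]eq_sym (negPf xa) (negPf xaa).
have fPR : (2 * #|f @: (P :\: R)| <= #|P :\: R|)%N.
  apply: mul_card_imset_leq => x /setDP[Px nRx].
  have [u Pu ncu] : exists2 u, u \in P & x ^ u != x.
    apply/exists_inP; apply: contraR nRx => /exists_inPn none.
    apply: (subsetP sZR); rewrite inE Px; apply/centP=> u Pu.
    by apply/commgP/conjg_fixP/eqP; rewrite -[_ == _]negbK none.
  rewrite -[2]/(1 + 1)%N.
  have: [set x; x ^ u] \subset [set y in P :\: R | f y == f x].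
    apply/subsetP=> y /set2P[]->; rewrite !inE ?Px ?nRx ?eqxx //=.
    rewrite memJ_norm ?(subsetP nRP) // nRx groupJ //=.
    by rewrite /f classGidl ?(subsetP sPG).
  by move/subset_leq_card; rewrite cards2 eq_sym ncu.
have f_split :
    (#|f @: P| <= #|f @: F| + #|f @: (R :\: F)| + #|f @: (P :\: R)|)%N.
  rewrite -{1}(setID P R) (setIidPr sRP).
  rewrite -{1}(setID R F) (setIidPr (subsetIl _ _)).
  rewrite !imsetU; apply: leq_trans (leq_card_setU _ _) _; rewrite leq_add2r.
  exact: leq_card_setU.
have cR := cardsID F R; rewrite (setIidPr (subsetIl _ _)) -/F in cR.
have cP := cardsID R P; rewrite (setIidPr sRP) in cP.
(* Inside [R] the count is at most $|F| + (|R| - |F|)/3 \le |R|/2$, since $|F| \le |R|/4$. *)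
by apply: leq_trans (leq_mul (leqnn 2) f_split) _; lia.
Qed.

(** * From many classes of $2$-elements to control of fusion, and the equivalence *)

Lemma num_2classes_fusion (gT : finGroupType) (G P : {group gT}) :
    2.-Sylow(G) P -> #|P| < 2 * num_p_classes 2 G ->
  #|P| < 2 * #|classes P| /\
  {in P & G, forall x g, x ^ g \in P -> x ^ g \in x ^: P}.
Proof.
move=> sylP many; have [sPG pP _] := and3P sylP.
have manyP : #|P| < 2 * #|classes P|.
  apply: leq_trans many _; rewrite leq_mul2l /= (num_p_classes_Sylow sylP).
  by rewrite (imset_class_support sPG) leq_imset_card.
split=> //.
have index_le2 : {in P, forall y, #|P : 'C_P[y]| <= 2}.
  move=> y Py; apply: leq_trans (index_cent1_leq_der1 Py) _.
  exact: card_der1_of_many_classes.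
apply: (fusion_of_local_control (p := 2)) => // y Py.
(* Failure of local control at [y] yields an odd-order element acting nontrivially on $C_P(y)$,
   which contains $Z(P)$, and so too few classes. *)
apply: contraLR many => notsub.
have nsRP : 'C_P[y] <| P.
  apply: (@index_leq_p_normal _ 2 P 'C_P[y]) (index_le2 y Py) => //.
  exact: subsetIl.
have [a [Na odd_a ncRa]] := exists_p'elt_not_cent sylP nsRP notsub.
rewrite -leqNgt; apply: num_2classes_leq_half nsRP _ Na _ ncRa => //.
  by apply: setIS; rewrite /= -cent_set1 centS // sub1set.
by move: odd_a; rewrite /p_elt -odd_2'nat.
Qed.

Theorem theoremA (gT : finGroupType) (G P : {group gT}) (sylP : 2.-Sylow(G) P) :
  (#|P| < 2 * num_p_classes 2 G)%N <->
  (exists N : {group gT}, normal_p_complement 2 G N) /\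
  (#|P| < 2 * #|classes P|)%N.
Proof.
split=> [many | [[N complN] many]].
  have [manyP fusP] := num_2classes_fusion sylP many; split=> //.
  exact: normal_p_complement_of_fusion sylP fusP.
rewrite (num_p_classes_of_fusion sylP) //.
exact: fusion_of_normal_p_complement complN.
Qed.
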